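(* Let $X\subset\mathbb{R}^n$ be a compact basic semialgebraic set, let $f,h_1,\dots,h_m\in\mathbb{R}[x]=\mathbb{R}[x_1,\dots,x_n]$ and $b=(b_1,\dots,b_m)\in\mathbb{R}^m$. Assume that $h_1\equiv 1$, that $b_1>0$, and that $b$ lies in the relative interior of the convex cone $$K=\Big\{\Big(\int_X h_i\,d\mu\Big)_{i=1,\dots,m}\ \Big|\ \mu\in\mathcal{M}_+(X)\Big\}\subseteq\mathbb{R}^m.$$ Then the problem $$\sup_{\lambda}\Big\{\sum_{i=1}^m b_i\lambda_i\ :\ f-\sum_{i=1}^m \lambda_i h_i\ge 0\ \text{on } X,\ \lambda\in\mathbb{R}^m\Big\}$$ attains its optimal value, i.e. the supremum is a maximum.
   Context: $\mathcal{M}_+(X)$ denotes the set of finite nonnegative Borel measures supported on $X$. The relative interior of a convex set $C\subseteq\mathbb{R}^m$ is its interior within its affine hull. The maximization problem is the dual of the generalized moment problem $\inf\{\int f\,d\mu : \int h_i\,d\mu=b_i,\ i=1,\dots,m,\ \mu\in\mathcal{M}_+(X)\}$. *)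

(* Defs.v *)
From HB Require Import structures.
From mathcomp Require Import all_boot all_order all_algebra.
From mathcomp Require Import all_classical all_reals all_analysis.
(* The notations of mpoly clash with those of mathcomp-analysis. *)
From mathcomp Require Import -(notations) mpoly.

Set Implicit Arguments.
Unset Strict Implicit.
Unset Printing Implicit Defensive.

Import Order.TTheory GRing.Theory Num.Theory.
Import numFieldNormedType.Exports.

Local Open Scope classical_set_scope.
Local Open Scope ring_scope.

(* 'rV[R]_n with the sigma-algebra generated by its open sets. *)
Notation borel_rV R n := (g_sigma_algebraType (@open 'rV[R]_n)).

Definition peval (R : realType) (n : nat) (p : mpoly n R) (x : 'rV[R]_n) : R :=
  meval (fun i => x ord0 i) p.

Definition basic_semialgebraic (R : realType) (n : nat) (X : set 'rV[R]_n) :=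
  exists (k : nat) (g : 'I_k -> mpoly n R),
    X = [set x | forall j, 0 <= peval (g j) x].

Definition measures_on (R : realType) (n : nat) (X : set 'rV[R]_n) :
    set {finite_measure set (borel_rV R n) -> \bar R} :=
  [set mu : {finite_measure set (borel_rV R n) -> \bar R} | mu (~` X) = 0%E].

Definition moment_cone (R : realType) (n m : nat) (X : set 'rV[R]_n)
    (h : 'I_m -> mpoly n R) : set 'rV[R]_m :=
  [set \row_(i < m) \int[mu]_(x in X) peval (h i) x | mu in measures_on X].

Definition affine_hull (R : realType) (V : lmodType R) (C : set V) : set V :=
  [set y | exists (k : nat) (a : 'I_k -> R) (x : 'I_k -> V),
     [/\ forall i, C (x i), \sum_(i < k) a i = 1 &
         y = \sum_(i < k) a i *: x i]].

(* The subspace topology of the library lives on the whole ambient type, with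
   every point outside the affine hull isolated; this adds nothing here because
   the interior of C is contained in C, hence in the affine hull. *)
Definition relative_interior (R : realType) (V : normedModType R)
    (C : set V) : set V :=
  (C : set (subspace (affine_hull C)))°.

Definition dual_feasible (R : realType) (n m : nat) (X : set 'rV[R]_n)
    (f : mpoly n R) (h : 'I_m -> mpoly n R) : set 'rV[R]_m :=
  [set l | forall x, X x ->
     0 <= peval (f - \sum_(i < m) l ord0 i *: h i) x].

Definition dual_objective (R : realType) (m : nat) (b l : 'rV[R]_m) : R :=
  \sum_(i < m) b ord0 i * l ord0 i.

Definition dual_value (R : realType) (n m : nat) (X : set 'rV[R]_n)
    (f : mpoly n R) (h : 'I_m -> mpoly n R) (b : 'rV[R]_m) : \bar R :=
  ereal_sup [set (dual_objective b l)%:E | l in dual_feasible X f h].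

(* Main.v *)
(* Write H(x) = (h_1(x), ..., h_m(x)). Integrating l.H <= f against a measure
   representing a point a of K bounds l.a above uniformly over the feasible l.
   For x in X the point H(x) lies in K (Dirac measure), so relative interiority
   puts (1+t) b - t H(x) in K for some t > 0; applying the bound at this point
   and at H(x) shows that l.H(x) is bounded on the feasible l with l.b >= v.
   Feasibility and objective depend on l only through its values on H(X), i.e.
   through finitely many numbers l.H(x_j), where the H(x_j) span the span of
   H(X). Projecting along the directions killed by the H(x_j) therefore leaves
   a compact set of competitors, on which the objective attains its maximum. *)
Require Import Defs.
From HB Require Import structures.
From mathcomp Require Import all_boot all_order all_algebra.
From mathcomp Require Import all_classical all_reals all_analysis.
From mathcomp Require Import -(notations) mpoly.
From mathcomp Require Import lra.

Set Implicit Arguments.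
Unset Strict Implicit.
Unset Printing Implicit Defensive.

Import Order.TTheory GRing.Theory Num.Theory.
Import numFieldNormedType.Exports.

Local Open Scope classical_set_scope.
Local Open Scope ring_scope.

(** * Spanning families and relative interiors *)

(** Take [A] of maximal rank among the matrices with rows in [H]. Appending some [v] of [H] as a row
    cannot raise the rank, so [v] already lies in the row space. *)
Lemma spanning_rows (F : fieldType) (n : nat) (H : set 'rV[F]_n) :
  exists k (A : 'M[F]_(k, n)),
    (forall i, H (row i A)) /\ forall v, H v -> (v <= A)%MS.
Proof.
pose P r := `[< exists k (A : 'M[F]_(k, n)),
  (forall i, H (row i A)) /\ \rank A = r >].
have P0 : exists r, P r.
  by exists 0%N; apply/asboolP; exists 0%N, 0; split=> [[]|] //; rewrite mxrank0.
have Pn r : P r -> (r <= n)%N.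
  by move=> /asboolP[k [A [_ <-]]]; exact: rank_leq_col.
case: (ex_maxnP P0 Pn) => r /asboolP[k [A [HA rA]]] rmax.
exists k, A; split=> // v Hv.
have sAv : (A <= col_mx A v)%MS by rewrite -addsmxE addsmxSl.
suff : (col_mx A v <= A)%MS by rewrite col_mx_sub => /andP[].
rewrite -(mxrank_leqif_sup sAv) eqn_leq mxrankS//= rA.
apply: rmax; apply/asboolP; exists (k + 1)%N, (col_mx A v); split=> // i.
by case: (split_ordP i) => j ->; rewrite ?rowKu ?rowKd ?row_id.
Qed.


(** The point [(1 + t) *: b - t *: y] is an affine combination of points of [C] and tends to [b] as
    [t] decreases to 0, so it enters any neighbourhood of [b] within the affine hull. *)
Lemma relative_interior_extend (R : realType) (V : normedModType R)
    (C : set V) (b y : V) :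
  relative_interior C b -> C y ->
  exists2 t : R, 0 < t & C ((1 + t) *: b - t *: y).
Proof.
move=> bC Cy; have Cb : C b by exact: (@interior_subset (subspace _) _ b bC).
have hullb : affine_hull C b.
  by exists 1%N, (fun=> 1), (fun=> b); rewrite !big_ord1 scale1r.
have {}bC : within (affine_hull C) (nbhs b) C.
  by rewrite nbhs_subspace_in.
pose g (t : R) := (1 + t) *: b - t *: y.
have g0 : g t @[t --> 0^'+] --> b.
  apply: cvg_at_right_filter.
  rewrite -[X in _ --> X](_ : (1 + 0) *: b - 0 *: y = b); last first.
    by rewrite addr0 scale1r scale0r subr0.
  apply: cvgB; apply: cvgZr_tmp; last exact: cvg_id.
  by apply: cvgD; [exact: cvg_cst|exact: cvg_id].
(* The neighbourhood filter gives membership in [C] only for points of the hull; the weights [1 + t]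
   and [- t] settle that condition below. *)
have [t [Cgt t0]] : exists t, (affine_hull C (g t) -> C (g t)) /\ 0 < t.
  apply: (@filter_ex _ (0^'+ : set_system R)).
  by apply: filterI; [exact: g0 bC|exact: nbhs_right_gt].
exists t => //; apply: Cgt.
exists 2%N, (fun i => if i == ord0 then 1 + t else - t),
  (fun i => if i == ord0 then b else y); split=> [i||].
- by case: ifP.
- by rewrite !big_ord_recl big_ord0 /= addr0 addrK.
- by rewrite !big_ord_recl big_ord0 /= addr0 scaleNr.
Qed.

(** * Continuity and linearity of polynomial evaluation *)

Section peval.
Context {R : realType} {n : nat}.
Implicit Types (p q : mpoly n R) (x : 'rV[R]_n).

Lemma continuous_peval p : continuous (peval p).
Proof.
rewrite /peval; under eq_fun do rewrite mevalE.
apply: continuous_big => [|a _ x]; first exact: add_continuous.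
apply: (@continuousM _ _ (cst (mcoeff a p))); first exact: cst_continuous.
apply: continuous_big => [|i _]; first exact: mul_continuous.
move=> y; apply: (@continuous_comp _ _ _ (fun z : 'rV[R]_n => z ord0 i)
  (fun r => r ^+ a i)); first exact: coord_continuous.
exact: exprn_continuous.
Qed.

Lemma pevalB p q x : peval (p - q) x = peval p x - peval q x.
Proof. exact: mevalB. Qed.

Lemma pevalZ c p x : peval (c *: p) x = c * peval p x.
Proof. exact: mevalZ. Qed.

Lemma peval_sum m (p : 'I_m -> mpoly n R) x :
  peval (\sum_i p i) x = \sum_i peval (p i) x.
Proof. exact: raddf_sum. Qed.

Lemma peval1 x : peval 1 x = 1.
Proof. exact: rmorph1. Qed.

End peval.

(** * Integration of polynomials over a compact set *)

Section integration.
Context {R : realType} {n : nat} {X : set 'rV[R]_n} (cX : compact X).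
Implicit Types (p : mpoly n R) (x : 'rV[R]_n).

Lemma measurable_compact_rV : measurable (X : set (borel_rV R n)).
Proof.
rewrite -[X]setCK; apply: measurableC; apply: sub_sigma_algebra.
exact: closed_openC (compact_closed (@norm_hausdorff R _) cX).
Qed.

Lemma measurable_peval p :
  measurable_fun (X : set (borel_rV R n)) (peval p : borel_rV R n -> R).
Proof.
apply: (measurability _ (measurable_realfun.RGenOpens.measurableE R)).
move=> _ [_ [a [b ->] <-]]; apply: measurableI.
  exact: measurable_compact_rV.
apply: sub_sigma_algebra.
by move/continuousP : (@continuous_peval _ _ p); apply; exact: interval_open.
Qed.

Lemma bounded_peval p : exists M, forall x, X x -> `|peval p x| <= M.
Proof.
have /compact_bounded[M [_ HM]] : compact (peval p @` X).
  by apply: continuous_compact => //; exact/continuous_subspaceT/continuous_peval.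
exists (M + 1) => x Xx; apply: (HM (M + 1)); first by rewrite ltrDl.
by exists x.
Qed.

Lemma integrable_peval (mu : {finite_measure set (borel_rV R n) -> \bar R}) p :
  mu.-integrable X (EFin \o peval p).
Proof.
apply: measurable_bounded_integrable.
- exact: measurable_compact_rV.
- by rewrite ltey_eq fin_num_measure//; exact: measurable_compact_rV.
- exact: measurable_peval.
- have [M HM] := bounded_peval p; exists M; split; first exact: num_real.
  by move=> y My x Xx; apply: (le_trans (HM _ Xx)); exact: ltW.
Qed.

Lemma Rintegral_peval_dirac x p : X x ->
  \int[\d_(x : borel_rV R n)]_(y in X) peval p y = peval p x.
Proof.
move=> Xx; rewrite /Rintegral integral_dirac.
- by rewrite diracE mem_set// mul1e.
- exact: measurable_compact_rV.
- by apply/measurable_realfun.measurable_EFinP; exact: measurable_peval.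
Qed.

Lemma Rintegral_sum_peval (mu : {finite_measure set (borel_rV R n) -> \bar R})
    m (p : 'I_m -> mpoly n R) :
  \int[mu]_(x in X) peval (\sum_i p i) x =
  \sum_i \int[mu]_(x in X) peval (p i) x.
Proof.
elim/big_rec2 : _ => [|i y q _ <-].
  by rewrite (@eq_Rintegral _ _ _ _ _ (cst 0)) ?Rintegral_cst ?mul0r//
    => [|x _]; rewrite ?/peval ?raddf0//; exact: measurable_compact_rV.
rewrite -RintegralD; [|exact: measurable_compact_rV|exact: integrable_peval..].
by apply: eq_Rintegral => x _; exact: mevalD.
Qed.

End integration.

Lemma continuous_dual_objective (R : realType) m (b : 'rV[R]_m) :
  continuous (dual_objective b).
Proof.
apply: continuous_big => [|i _ l]; first exact: add_continuous.
apply: (@continuousM _ _ (cst (b ord0 i))); first exact: cst_continuous.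
exact: coord_continuous.
Qed.

(** * Weak duality and bounds on feasible points *)

Section duality.
Context {R : realType} {n m : nat} {X : set 'rV[R]_n} (cX : compact X).
Variables (f : mpoly n R) (h : 'I_m -> mpoly n R).
Implicit Types (l a b : 'rV[R]_m).

Local Notation slack l := (f - \sum_(i < m) l ord0 i *: h i).
Local Notation ev x := (\row_(i < m) peval (h i) x).

Lemma peval_slack l x :
  peval (slack l) x = peval f x - dual_objective (ev x) l.
Proof.
rewrite pevalB peval_sum; congr (_ - _).
by apply: eq_bigr => i _; rewrite pevalZ mxE mulrC.
Qed.

Lemma dual_feasibleE l : dual_feasible X f h l <->
  forall x, X x -> dual_objective (ev x) l <= peval f x.
Proof.
by split=> H x /H; rewrite peval_slack subr_ge0.
Qed.

(** This identity ties measures to dual points: a nonnegative slack yields weak duality, and slacks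
    equal on [X] yield equal objectives. *)
Lemma Rintegral_slack (mu : {finite_measure set (borel_rV R n) -> \bar R}) l :
  \int[mu]_(x in X) peval (slack l) x = \int[mu]_(x in X) peval f x -
    dual_objective (\row_i \int[mu]_(x in X) peval (h i) x) l.
Proof.
have mX := measurable_compact_rV cX.
under eq_Rintegral do rewrite pevalB.
rewrite RintegralB//; [|exact: integrable_peval..].
rewrite Rintegral_sum_peval//; congr (_ - _); apply: eq_bigr => i _.
under eq_Rintegral do rewrite pevalZ.
by rewrite RintegralZl// 1?mulrC ?mxE//; exact: integrable_peval.
Qed.

Lemma moment_cone_ev x : X x -> moment_cone X h (ev x).
Proof.
move=> Xx; exists (\d_(x : borel_rV R n) : {finite_measure set _ -> \bar R}).
  by rewrite /measures_on/= diracE memNset//; exact.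
by apply/rowP => i; rewrite !mxE Rintegral_peval_dirac.
Qed.

Lemma weak_duality a : moment_cone X h a ->
  exists v, forall l, dual_feasible X f h l -> dual_objective a l <= v.
Proof.
move=> [mu _ <-]; exists (\int[mu]_(x in X) peval f x) => l fl.
by rewrite -subr_ge0 -Rintegral_slack; exact: Rintegral_ge0.
Qed.

(** Up to sign and the constant integral of [f], the objective at a point of the cone is the
    integral of the slack, which only sees values on [X]. *)
Lemma eq_dual_objective a l l' : moment_cone X h a ->
  (forall x, X x -> dual_objective (ev x) l = dual_objective (ev x) l') ->
  dual_objective a l = dual_objective a l'.
Proof.
move=> [mu _ <-] ll'.
apply/oppr_inj/(addrI (\int[mu]_(x in X) peval f x)).
rewrite -!Rintegral_slack; apply: eq_Rintegral => x /set_mem Xx.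
by rewrite !peval_slack ll'.
Qed.

Lemma dual_objective_comb a b l s t :
  dual_objective (s *: a - t *: b) l =
  s * dual_objective a l - t * dual_objective b l.
Proof.
rewrite /dual_objective !mulr_sumr -sumrB; apply: eq_bigr => i _.
by rewrite !mxE mulrBl !mulrA.
Qed.

Lemma bounded_superlevel b (v : R) x :
  relative_interior (moment_cone X h) b -> X x ->
  exists C, forall l, dual_feasible X f h l -> v <= dual_objective b l ->
    `|dual_objective (ev x) l| <= C.
Proof.
move=> bK Xx; have Kx := moment_cone_ev Xx.
have [t t0 /weak_duality[w Hw]] := relative_interior_extend bK Kx.
have [M HM] := weak_duality Kx.
(* [M] bounds the value above. Solving [(1 + t) * v - t * s <= w] for [s] gives the lower bound; the
   sum of absolute values covers both. *)
exists (`|M| + `|((1 + t) * v - w) / t|) => l fl vl.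
have := HM _ fl; have := Hw _ fl; rewrite dual_objective_comb => lo hi.
rewrite ler_norml; apply/andP; split; last first.
  by apply: (le_trans hi); rewrite (le_trans (ler_norm M))// lerDl.
apply: (@le_trans _ _ (((1 + t) * v - w) / t)).
  by rewrite lerNl (le_trans (ler_norm _))// normrN lerDr.
rewrite ler_pdivrMr//.
have : (1 + t) * v <= (1 + t) * dual_objective b l.
  by rewrite ler_pM2l// addr_gt0.
by rewrite [_ * t]mulrC; lra.
Qed.

End duality.

(** * Attainment by compactness *)

Theorem theorem1p1 (R : realType) (n m : nat) (X : set 'rV[R]_n)
    (f : mpoly n R) (h : 'I_m.+1 -> mpoly n R) (b : 'rV[R]_m.+1)
    (X_semialgebraic : basic_semialgebraic X) (X_compact : compact X)
    (h1 : h ord0 = 1) (b1 : 0 < b ord0 ord0)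
    (b_relint : relative_interior (moment_cone X h) b) :
  exists l : 'rV[R]_m.+1,
    dual_feasible X f h l /\ (dual_objective b l)%:E = dual_value X f h b.
Proof.
have bK : moment_cone X h b.
  exact: (@interior_subset (subspace _) _ b b_relint).
pose ev x : 'rV[R]_m.+1 := \row_i peval (h i) x.
have [k [A [HA spanA]]] := spanning_rows [set ev x | x in X].
have [M HM] := bounded_peval X_compact f.
(* As [h ord0 = 1], the combination given by [l0] is the constant [- M], a lower bound of [f] on
   [X]. *)
pose l0 : 'rV[R]_m.+1 := - M *: delta_mx 0 0.
have fl0 : dual_feasible X f h l0.
  apply/dual_feasibleE => x /HM; rewrite ler_norml => /andP[+ _].
  apply: le_trans; rewrite /dual_objective big_ord_recl.
  rewrite big1 => [|i _]; rewrite !mxE ?mulr0//.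
  by rewrite h1 peval1 mul1r mulr1 addr0.
set v := dual_objective b l0.
have /choice[C HC] (j : 'I_k) : exists c, forall l, dual_feasible X f h l ->
    v <= dual_objective b l -> `|dual_objective (row j A) l| <= c.
  by have [x Xx <-] := HA j; exact: bounded_superlevel.
(* [pinvmx A *m A] fixes the row space of [A], which contains every [ev x], so [proj l] has the same
   values on [X] as [l] but depends only on [A *m l^T]. *)
pose proj (l : 'rV[R]_m.+1) : 'rV_m.+1 := (pinvmx A *m (A *m l^T))^T.
have dualE (a l : 'rV[R]_m.+1) : dual_objective a l = (a *m l^T) 0 0.
  by rewrite mxE; apply: eq_bigr => i _; rewrite mxE.
have evproj l x : X x ->
    dual_objective (ev x) (proj l) = dual_objective (ev x) l.
  move=> Xx; rewrite !dualE trmxK (mulmxA _ (pinvmx A)) (mulmxA _ A) mulmxKpV//.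
  by apply: spanA; exists x.
have fproj l : dual_feasible X f h l -> dual_feasible X f h (proj l).
  move=> /dual_feasibleE fl; apply/dual_feasibleE => x Xx.
  by rewrite evproj//; exact: fl.
have bproj l : dual_objective b (proj l) = dual_objective b l.
  by apply: (eq_dual_objective X_compact f bK) => x; exact: evproj.
(* Coordinate [i] of [proj l] is the sum over [j] of [pinvmx A i j] times entry [j] of [A *m l^T],
   an entry bounded by [C j] when [l] is feasible with objective at least [v]. *)
pose r i := \sum_j `|pinvmx A i j| * C j.
pose box := [set l : 'rV[R]_m.+1 | forall i, `[- r i, r i]%classic (l ord0 i)].
have boxproj l : dual_feasible X f h l -> v <= dual_objective b l ->
    box (proj l).
  move=> fl vl i; rewrite /= in_itv/= -ler_norml !mxE.
  apply: (le_trans (ler_norm_sum _ _ _)); apply: ler_sum => j _.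
  rewrite normrM ler_wpM2l//.
  suff -> : (A *m l^T) j 0 = dual_objective (row j A) l by exact: HC.
  by rewrite dualE !mxE; apply: eq_bigr => s _; rewrite !mxE.
pose S := box `&` dual_feasible X f h.
have cS : compact S.
  apply: compact_closedI.
    apply: (rV_compact (A := fun i => `[- r i, r i]%classic)) => i.
    exact: segment_compact.
  (* The feasible set is closed, being an intersection of closed sets given by one linear inequality
     for each [x] in [X]. *)
  rewrite (_ : dual_feasible X f h = \bigcap_(x in X)
      (dual_objective (ev x) @^-1` [set y | y <= peval f x])); last first.
    by apply/seteqP; split=> l /dual_feasibleE.
  apply: closed_bigI => x _; apply: preimage_closed; last exact: closed_le.
  by move=> ? _; exact: continuous_dual_objective.
have S0 : S !=set0.
  by exists (proj l0); split; [exact: boxproj|exact: fproj].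
have [l /set_mem[lbox fl] lmax] := compact_EVT_max S0 cS
  (continuous_subspaceT (@continuous_dual_objective _ _ b)).
exists l; split=> //; apply/eqP; rewrite eq_le; apply/andP; split.
  by apply: ereal_sup_ubound; exists l.
apply: ge_ereal_sup => _ [l' fl' <-]; rewrite lee_fin.
(* Only points with objective at least [v] are known to project into the box; the others are beaten
   by [proj l0], whose objective is [v]. *)
have [vl'|/ltW l'v] := leP v (dual_objective b l').
  rewrite -bproj; apply/lmax/mem_set; split; [exact: boxproj|exact: fproj].
apply: (le_trans l'v); rewrite /v -bproj; apply/lmax/mem_set.
by split; [exact: boxproj|exact: fproj].
Qed.
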